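(* Let $f\in\mathbb{Q}[x]$ be irreducible of degree $d\ge2$. If $f$ has a binomial multiple, and the minimal degree of such a binomial multiple is $m$, then $m\le d\cdot(\lceil 3d\ln\ln d\rceil+7)$.
   Context: A binomial multiple of $f$ is a multiple of $f$ in $\mathbb{Q}[x]$ of the form $x^m-r$ with $m\ge1$ and $r\in\mathbb{Q}$. *)

(* Defs.v *)
From HB Require Import structures.
From mathcomp Require Import all_boot all_order all_algebra.
From mathcomp Require Import all_classical all_reals all_analysis.
From mathcomp Require Import Rstruct Rstruct_topology.
Set Implicit Arguments. Unset Strict Implicit. Unset Printing Implicit Defensive.
Import Order.TTheory GRing.Theory Num.Theory.
Local Open Scope ring_scope.

Definition has_binomial_multiple_deg (f : {poly rat}) (m : nat) : Prop :=
  (0 < m)%N /\ exists r : rat, f %| 'X^m - r%:P.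

Definition min_binomial_multiple_deg (f : {poly rat}) (m : nat) : Prop :=
  has_binomial_multiple_deg f m /\
  forall k : nat, has_binomial_multiple_deg f k -> (m <= k)%N.

Definition paper_bound (d : nat) : int :=
  d%:Z * (Num.ceil (3 * (d%:R : Rdefinitions.R) * ln (ln (d%:R : Rdefinitions.R))) + 7).

(* Main.v *)
(* Let [a] be a root of [f], [K = Q(a)], let [z] of order [N] generate the group
   of roots of unity in [K] of order dividing [m], and let [e = [K : Q(z)]], so
   that [e * totient N = d].
   The conjugates of [a] are [a] times [m]-th roots of unity, so the constant
   coefficient of the minimal polynomial of [a] over [Q(z)] is [a ^ e] times a
   root of unity; the latter lies in [K], hence in [Q(z)], and so does [a ^ e].
   A conjugate of [a ^ e] is then [a ^ e] times an [m]-th root of unity in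
   [Q(z)], that is, an [N]-th root of unity, so [a ^ (e * N)] is rational and
   [m <= e * N].  This gains a factor of order [d] over the bound [m <= d * n]
   ([totient n <= d]) given by the norm of [a], so the crude
   [N <= 2 * totient N ^ 2] suffices: it yields [m <= 2 * d ^ 2]. *)
Require Import Defs.
From HB Require Import structures.
From mathcomp Require Import all_boot all_order all_algebra.
From mathcomp Require Import all_classical all_reals all_analysis.
From mathcomp Require Import Rstruct Rstruct_topology.
From mathcomp Require Import all_field.
From mathcomp Require Import lra zify.
Import Order.TTheory GRing.Theory Num.Theory.
Local Open Scope ring_scope.

(** * Quadratic lower bounds for Euler's totient *)

(** By multiplicativity, splitting off the full power of one prime [p] leaves
    [p ^ a.+1 <= (p.-1 * p ^ a) ^ 2]. This follows from [p <= p.-1 ^ 2], which holds for [p >= 3]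
    but fails for [p = 2]. *)
Lemma leq_totient_sqr_odd (n : nat) : odd n -> (n <= totient n ^ 2)%N.
Proof.
elim/ltn_ind: n => n IHn n_odd; have n_gt0 := odd_gt0 n_odd.
have [n_le1|n_gt1] := leqP n 1; first by case: n {IHn n_odd} n_gt0 n_le1 => [|[]].
set p := pdiv n; have p_pr : prime p := pdiv_prime n_gt1.
have p_odd : odd p by apply: dvdn_odd (pdiv_dvd n) n_odd.
have p_gt2 := odd_prime_gt2 p_odd p_pr.
have [k co_pk Dn] := pfactor_coprime p_pr n_gt0.
have a_gt0 : (0 < logn p n)%N by rewrite logn_gt0 mem_primes p_pr n_gt0 pdiv_dvd.
case: (logn p n) a_gt0 Dn => // a _ Dn.
have k_odd : odd k by move: n_odd; rewrite Dn oddM => /andP[].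
have k_lt : (k < n)%N.
  by rewrite Dn ltn_Pmulr ?(odd_gt0 k_odd) // -(exp1n a.+1) ltn_exp2r ?prime_gt1.
have co_kp : coprime k (p ^ a.+1) by rewrite coprimeXr // coprime_sym.
rewrite Dn totient_coprime // totient_pfactor //= expnMn.
apply: leq_mul; first exact: IHn.
have pa_gt0 : (0 < p ^ a)%N by rewrite expn_gt0 prime_gt0.
rewrite expnMn expnS; apply: leq_mul; last by rewrite -[leqLHS]expn1 leq_pexp2l.
by case: p p_gt2 {p_pr p_odd co_pk Dn co_kp pa_gt0} => // p; nia.
Qed.

(** The 2-part costs at most a factor 2, since [2 ^ a.+1 <= 2 * (2 ^ a) ^ 2]. *)
Lemma leq_totient_sqr (n : nat) : (n <= 2 * totient n ^ 2)%N.
Proof.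
have [->//|n_gt0] := posnP n.
have [k co_2k Dn] := pfactor_coprime (isT : prime 2) n_gt0.
have k_odd : odd k by rewrite -coprime2n.
have k_le := leq_totient_sqr_odd _ k_odd.
case: (logn 2 n) Dn => [|a] ->; first by rewrite muln1 (leq_trans k_le) ?leq_pmull.
have co_k2 : coprime k (2 ^ a.+1) by rewrite coprimeXr // coprime_sym.
rewrite totient_coprime // totient_pfactor // expnMn mulnCA leq_mul //.
by rewrite mul1n expnS leq_mul // -[leqLHS]expn1 leq_pexp2l ?expn_gt0.
Qed.

(** * Radicals and roots of unity in a Galois number field *)

Section NumField.
Variables (L : splittingFieldType rat) (LC : {rmorphism L -> algC}).

Lemma num_field_galois (a : L) :
  (forall s, s \in 'Gal({:L} / 1)%g -> s a = a) -> a \in 1%VS.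
Proof.
have galL : galois 1 {:L}.
  rewrite /galois subvf normalFieldf andbT /=.
  apply/separableP=> u _; apply: pcharf0_separable.
  exact: ftrans (pchar_lalg L) (pchar_num _).
move=> fix_a; rewrite -(galois_fixedField galL); exact/fixedFieldP/fix_a/memvf.
Qed.

(** Over the complex numbers the minimal polynomial of [z] becomes a rational polynomial vanishing
    at [LC z], so the cyclotomic polynomial divides it. *)
Lemma totient_dim (n : nat) (z : L) :
  n.-primitive_root z -> (totient n <= adjoin_degree 1 z)%N.
Proof.
move=> prim_z; have [p [Dp _ pP]] := minCpolyP (LC z).
have prim_zC : n.-primitive_root (LC z) by rewrite fmorph_primitive_root.
rewrite -ltnS -size_minPoly -(size_cyclotomic (LC z) n).
rewrite -(minCpoly_cyclotomic prim_zC).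
have /polyOver1P[q Dq] := minPolyOver 1 z.
have qz : root (map_poly ratr q) (LC z).
  rewrite -[map_poly _ _](_ : map_poly LC (minPoly 1 z) = _).
    by rewrite fmorph_root root_minPoly.
  rewrite Dq -map_poly_comp; apply: eq_map_poly => x /=.
  by rewrite alg_num_field fmorph_rat.
have q0 : q != 0.
  apply: contraTneq (monic_minPoly 1 z) => q0.
  by rewrite Dq q0 rmorph0 monicE lead_coef0 eq_sym oner_eq0.
by rewrite Dp Dq !size_map_poly dvdp_leq // -pP.
Qed.

Lemma radical_exponent (a w : L) (m : nat) :
  a != 0 -> m.-primitive_root w -> a ^+ m \in 1%VS ->
  exists e N : nat, [/\ (0 < e)%N, (0 < N)%N,
    (e * totient N <= adjoin_degree 1 a)%N & a ^+ (e * N) \in 1%VS].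
Proof.
move=> a0 prim_w Qam; have m_gt0 := prim_order_gt0 prim_w.
pose K := <<1; a>>%AS.
(* With [g] the least positive exponent such that [w ^+ g] lies in [K], division with remainder
   shows that [w ^+ g] generates the [m]-th roots of unity in [K]. *)
have [|g /andP[g_gt0 Kwg] g_min] :=
  ex_minnP (P := fun i => (0 < i)%N && (w ^+ i \in K)).
  by exists m; rewrite m_gt0 (prim_expr_order prim_w) rpred1.
have w0 : w != 0.
  by move: (oner_neq0 L); rewrite -(prim_expr_order prim_w) expf_eq0 m_gt0.
have g_dvd i : w ^+ i \in K -> (g %| i)%N.
  move=> Kwi; have Kr : w ^+ (i %% g) \in K.
    have -> : w ^+ (i %% g) = w ^+ i / (w ^+ g) ^+ (i %/ g).
      rewrite {2}(divn_eq i g) exprD mulnC exprM mulrAC.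
      by rewrite divff ?mul1r // !expf_neq0.
    by apply: rpred_div => //; apply: rpredX.
  rewrite /dvdn -leqn0 leqNgt; apply/negP=> r_gt0.
  have := g_min (i %% g)%N; rewrite r_gt0 Kr => /(_ isT).
  by rewrite leqNgt ltn_pmod.
have g_m : (g %| m)%N by rewrite g_dvd // (prim_expr_order prim_w) rpred1.
pose N := (m %/ g)%N; pose z := w ^+ g.
have Dm : m = (N * g)%N by rewrite divnK.
have N_gt0 : (0 < N)%N by rewrite divn_gt0 // dvdn_leq.
have prim_z : N.-primitive_root z.
  have -> : z = w ^+ (m %/ N) by rewrite /z Dm mulKn.
  by rewrite dvdn_prim_root // Dm dvdn_mulr.
pose L0 := <<1; z>>%AS.
have sL0K : (L0 <= K)%VS by apply/FadjoinP; rewrite sub1v.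
have L0z : z \in L0 by exact: memv_adjoin.
have rootK x : x \in K -> x ^+ m = 1 -> x \in L0 /\ x ^+ N = 1.
  move=> Kx /(prim_rootP prim_w)[i Dx]; rewrite Dx in Kx.
  have /dvdnP[j Dj] := g_dvd _ Kx; rewrite Dx Dj mulnC exprM -/z.
  by rewrite rpredX // -exprM mulnC exprM (prim_expr_order prim_z) expr1n.
pose e := adjoin_degree L0 a.
have Ka : a \in K by exact: memv_adjoin.
have L0ae : a ^+ e \in L0.
  have [r /eqP Dr] := splitting_field_normal L0 a.
  have sz_r : size r = e.
    by apply: succn_inj; rewrite -size_minPoly Dr size_prod_XsubC.
  have rm b : b \in r -> b ^+ m = a ^+ m.
    rewrite -root_prod_XsubC -Dr => rb.
    have /root_dvdp/(_ rb) : minPoly L0 a %| 'X^m - (a ^+ m)%:P.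
      apply: minPoly_dvdp; last by rewrite rootE !hornerE subrr.
      by rewrite rpredB ?rpredX ?polyOverX ?polyOverC // (subvP (sub1v _)).
    by rewrite rootE !hornerE subr_eq0 => /eqP.
  (* Up to sign, [x] is the constant coefficient of [minPoly L0 a]. It has the same [m]-th power as
     [a ^+ e], so [rootK] applies to their quotient. *)
  pose x := \prod_(b <- r) b.
  have L0x : x \in L0.
    have: (minPoly L0 a).[0] \in L0.
      by rewrite rpred_horner ?minPolyOver ?rpred0.
    rewrite Dr horner_prod.
    under eq_bigr do rewrite hornerXsubC sub0r -mulN1r.
    by rewrite big_split /= big_const_seq iter_mulr_1 rpredMsign.
  have xm : x ^+ m = (a ^+ e) ^+ m.
    rewrite -prodrXl (eq_big_seq _ rm) big_const_seq iter_mulr_1.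
    by rewrite count_predT sz_r -!exprM mulnC.
  have x0 : x != 0.
    have: x ^+ m != 0 by rewrite xm; do 2!apply: expf_neq0.
    by rewrite expf_eq0 m_gt0.
  have [||] := rootK (a ^+ e / x).
  - by apply: rpred_div; [exact: rpredX | exact: (subvP sL0K)].
  - by rewrite expr_div_n xm divff ?expf_neq0.
  - by move=> L0q _; rewrite -[a ^+ e](divfK x0) rpredM.
exists e, N; split=> //.
(* Tower law: [L0(a)] has degree [e * [L0 : Q]] and lies in [K]. *)
- have := dimvS (_ : <<L0; a>> <= K)%VS; rewrite !dim_Fadjoin dimv1 !muln1.
  move=> le_eK; apply: leq_trans (le_eK _); last by apply/FadjoinP.
  by rewrite leq_mul2l totient_dim // orbT.
apply: num_field_galois => s Gs.
have s1 v : v \in 1%VS -> s v = v by apply: fixed_gal; rewrite ?sub1v ?subvf.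
have sX v k : s (v ^+ k) = s v ^+ k by rewrite rmorphXn.
(* [s] need not preserve [K], but it preserves [L0], since it sends [z] to a power of [z]. Hence
   [s (a ^+ e) / a ^+ e] stays in [K]. *)
have L0s v : v \in L0 -> s v \in L0.
  have L0sz : s z \in L0.
    have [|i ->] := prim_rootP prim_z (_ : s z ^+ N = 1); last exact: rpredX.
    by rewrite -sX (prim_expr_order prim_z) rmorph1.
  move=> /Fadjoin_polyP[p Qp ->].
  rewrite -horner_map (fixedPoly_gal _ Gs) ?subvf //.
  by rewrite rpred_horner // (polyOverSv (sub1v _)).
have ae0 : a ^+ e != 0 by rewrite expf_neq0.
have [||_] := rootK (s (a ^+ e) / a ^+ e).
- by rewrite (subvP sL0K) //; apply: rpred_div => //; apply: L0s.
- rewrite expr_div_n -sX -exprM mulnC exprM.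
  by rewrite (s1 _ (rpredX e Qam)) divff ?expf_neq0.
move/eqP; rewrite expr_div_n -sX -exprM.
by rewrite -(inj_eq (mulIf (expf_neq0 (e * N) a0))) divfK ?expf_neq0 // mul1r => /eqP.
Qed.

End NumField.

(** * Passage between complex roots and number fields *)

Lemma splitting_num_field (p : {poly rat}) :
  p != 0 -> exists (L : splittingFieldType rat) (LC : {rmorphism L -> algC}),
    forall x : algC, root (map_poly ratr p) x -> exists y : L, LC y = x.
Proof.
move=> p0; have [rs Dp] := closed_field_poly_normal (map_poly ratr p : {poly algC}).
have lc0 : lead_coef (map_poly ratr p : {poly algC}) != 0.
  by rewrite lead_coef_eq0 map_poly_eq0.
have [F [FC [rs1 Drs gen_rs1]]] := num_field_exists rs.
have splitF : splitting_field_axiom F.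
  exists (map_poly (in_alg F) p); first by apply/polyOver1P; exists p.
  exists rs1 => //; rewrite -(eqp_map FC) -map_poly_comp.
  rewrite (@eq_map_poly _ _ _ ratr) => [|x]; last first.
    by rewrite /= alg_num_field fmorph_rat.
  rewrite Dp rmorph_prod /= (eqp_trans (eqp_scale _ lc0)) // -Drs big_map.
  by rewrite [X in _ %= X](eq_bigr _ (fun y _ => map_polyXsubC FC y)) eqpxx.
pose splitF_mixin := FieldExt_isSplittingField.Build _ F splitF.
pose L : splittingFieldType rat := HB.pack F splitF_mixin.
exists L, FC => x; rewrite Dp rootZ // root_prod_XsubC -Drs.
by case/mapP=> y _ ->; exists y.
Qed.

(** The minimal polynomial of [x] is nonconstant and divides [f], so it is an associate of [f]. *)
Lemma irreducible_dvdp_root (f q : {poly rat}) (x : algC) :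
  irreducible_poly f -> root (map_poly ratr f) x -> root (map_poly ratr q) x ->
  f %| q.
Proof.
move=> [_ f_irr]; have [p [Dp _ pP]] := minCpolyP x; rewrite !pP => pf pq.
rewrite -(eqp_dvdl _ (f_irr p _ pf)) //.
by have := size_minCpoly x; rewrite Dp size_map_poly; case: (size p) => [|[]].
Qed.

(** * Numerical estimates for the iterated logarithm *)

(** From [1 - t <= expR (- t)], the number [u >= 1 / (1 - t)] bounds [expR t]. Cutting an exponent
    into [n] equal pieces makes this crude bound sharp enough. *)
Lemma expR_le_expr (R : realType) (t u : R) (n : nat) :
  t < 1 -> 1 <= u * (1 - t) -> expR (n%:R * t) <= u ^+ n.
Proof.
move=> t1 ut; have t1' : 0 < 1 - t by rewrite subr_gt0.
have ge_exp : expR t <= (1 - t)^-1.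
  by rewrite -[expR t]invrK -expRN lef_pV2 ?posrE ?expR_gt0 // expR_ge1Dx.
have le_u : expR t <= u by rewrite (le_trans ge_exp) // -[_^-1]mul1r ler_pdivrMr.
by rewrite expRM_natl lerXn2r ?nnegrE ?(le_trans _ le_u) ?expR_ge0.
Qed.

Lemma ln_ln_ge (R : realType) (x y z : R) :
  expR x <= y -> expR y <= z -> x <= ln (ln z).
Proof.
move=> xy yz; have y0 : 0 < y := lt_le_trans (expR_gt0 x) xy.
have z0 : 0 < z := lt_le_trans (expR_gt0 y) yz.
have y_ln : y <= ln z by rewrite -[y]expRK ler_ln ?posrE ?expR_gt0.
by rewrite -[x]expRK ler_ln ?posrE ?expR_gt0 ?(lt_le_trans y0) ?(le_trans xy).
Qed.

(* For integral [d], [2 * d <= ceil x + 7] is equivalent to [2 * d - 8 < x].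
   On each range of [d] a rational lower bound for [ln (ln d)] suffices. *)
Lemma ln_ln_gt (R : realType) (d : nat) :
  (2 <= d)%N -> 2 * d%:R - 8 < 3 * d%:R * ln (ln d%:R) :> R.
Proof.
have step (s u t v : R) (k n c : nat) :
    s < 1 -> 1 <= u * (1 - s) -> u ^+ k <= n%:R * t ->
    t < 1 -> 1 <= v * (1 - t) -> v ^+ n <= c%:R -> (c <= d)%N ->
    k%:R * s <= ln (ln d%:R).
  move=> s1 us ut t1 vt vc cd; apply: (ln_ln_ge _ _ (n%:R * t)).
    exact: le_trans (expR_le_expr _ _ _ _ s1 us) ut.
  apply: le_trans (expR_le_expr _ _ _ _ t1 vt) (le_trans vc _).
  by rewrite ler_nat.
(* A lower bound [q] for [ln (ln d)] settles all [d] with [(2 - 3 * q) * d < 8]: every [d] for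
   [q = 2/3], [d < 16] for [q = 1/2], [d < 8] for [q = 1/3], and [d <= 4] for [q = 1/51]. *)
move=> d2; have [d16|] := leqP 16 d.
  have hd : 16 <= d%:R :> R by rewrite ler_nat.
  have h : 4 * (1 / 6) <= ln (ln d%:R) :> R.
    by apply: (step _ (6/5) (7 / 20) (20/13) _ 6 16)%N => //; lra.
  nra.
have [d8 d16|] := leqP 8 d.
  have hd : (8%:R <= (d%:R : R) <= 15%:R) by rewrite !ler_nat d8.
  have h : 2 * (1 / 4) <= ln (ln d%:R) :> R.
    by apply: (step _ (4/3) (2 / 9) (9/7) _ 8 8)%N => //; lra.
  nra.
have [d5 d8|] := leqP 5 d.
  have hd : (5%:R <= (d%:R : R) <= 7%:R) by rewrite !ler_nat d5.
  have h : 1%:R * (1 / 3) <= ln (ln d%:R) :> R.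
    by apply: (step _ (3/2) (1 / 8) (8/7) _ 12 5)%N => //; lra.
  nra.
have [d3 d5|] := leqP 3 d.
  have hd : (3%:R <= (d%:R : R) <= 4%:R) by rewrite !ler_nat d3.
  have h : 1%:R * (1 / 51) <= ln (ln d%:R) :> R.
    by apply: (step _ (51/50) (51 / 500) (500/449) _ 10 3)%N => //; lra.
  nra.
move=> d3; have -> : d = 2%N by lia.
(* Here [ln (ln 2)] is negative. The intermediate value is [5/8 = 1 / (1 + 3/5)], which is at least
   [expR (- (3/5))], and [(8/7) ^ 5 < 2]. *)
have h : - (3 / 5) <= ln (ln 2%:R) :> R.
  apply: (ln_ln_ge _ _ (5%:R * (1 / 8))).
    rewrite expRN -[leRHS]invrK lef_pV2 ?posrE ?expR_gt0 //.
    by apply: le_trans (expR_ge1Dx _); lra.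
  by apply: le_trans (expR_le_expr _ _ (8 / 7) 5%N _ _) _; lra.
lra.
Qed.

Lemma paper_bound_ge (d : nat) :
  (2 <= d)%N -> (d * (2 * d))%N%:Z <= paper_bound d.
Proof.
move=> d2; rewrite /paper_bound.
set x := _ * ln _; have := ln_ln_gt Rdefinitions.R d d2; rewrite -/x => hx.
have : 2 * d%:Z - 8 < Num.ceil x.
  rewrite -(ltr_int Rdefinitions.R); apply: lt_le_trans (ceil_ge x).
  by rewrite intrB intrM.
move=> hc; rewrite !PoszM ler_wpM2l //.
by rewrite -ltzD1 -addrA -ltrBlDr.
Qed.

(** * The degree bound *)

Theorem theorem3p3 (f : {poly rat}) (d m : nat) :
  irreducible_poly f -> size f = d.+1 -> (2 <= d)%N ->
  min_binomial_multiple_deg f m ->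
  m%:Z <= paper_bound d.
Proof.
move=> f_irr sz_f d_ge2 [[m_gt0 [r f_dvd]] m_min].
apply: le_trans (paper_bound_ge _ d_ge2); rewrite lez_nat.
pose p : {poly rat} := 'X^m - r%:P.
have p0 : p != 0 by rewrite -size_poly_eq0 size_XnsubC.
have [L [LC liftL]] := splitting_num_field p p0.
have rootp x : root (map_poly ratr p) x = (x ^+ m == ratr r :> algC).
  by rewrite /p rmorphB /= map_polyXn map_polyC rootE !hornerE subr_eq0.
have /closed_rootP[x fx] : size (map_poly ratr f : {poly algC}) != 1%N.
  by rewrite size_map_poly sz_f; case: d d_ge2 {sz_f}.
have px : root (map_poly ratr p) x.
  by move: fx; rewrite -!dvdp_XsubCl => /dvdp_trans; apply; rewrite dvdp_map.
(* If 0 were a root, [f] would be an associate of ['X], against [d >= 2]. *)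
have x0 : x != 0.
  apply: contraTneq fx => ->; rewrite -(rmorph0 (@ratr algC)) fmorph_root.
  apply/negP; rewrite -dvdp_XsubCl => /(f_irr.2 _).
  rewrite size_XsubC => /(_ isT)/eqp_size.
  by rewrite size_XsubC sz_f => -[d1]; rewrite -d1 in d_ge2.
have [w prim_w] := C_prim_root_exists m_gt0.
have [a Da] := liftL x px.
(* Both [x] and [x * w] are roots of [p], so the quotient of their lifts puts a primitive [m]-th
   root of unity in [L]. *)
have [b Db] : exists b, LC b = x * w.
  apply: liftL; rewrite rootp exprMn (prim_expr_order prim_w) mulr1.
  by rewrite -rootp.
have prim_ba : m.-primitive_root (b / a).
  rewrite -(fmorph_primitive_root LC) fmorph_div Da Db.
  by rewrite mulrAC divff // mul1r.
have a0 : a != 0 by rewrite -(fmorph_eq0 LC) Da.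
have Qam : a ^+ m \in 1%VS.
  apply/vlineP; exists r; apply: (fmorph_inj LC); rewrite rmorphXn /= Da.
  by rewrite alg_num_field fmorph_rat; apply/eqP; rewrite -rootp.
have deg_a : (adjoin_degree 1 a <= d)%N.
  rewrite -ltnS -size_minPoly -sz_f -(size_map_poly (in_alg L)).
  apply: dvdp_leq.
    by rewrite map_poly_eq0 -size_poly_eq0 sz_f.
  apply: minPoly_dvdp; first by apply/polyOver1P; exists f.
  rewrite -(fmorph_root LC) Da -map_poly_comp.
  rewrite (@eq_map_poly _ _ _ ratr) // => y.
  by rewrite /= alg_num_field fmorph_rat.
have [e [N [e_gt0 N_gt0 eN_le /vlineP[s Ds]]]] :=
  radical_exponent L LC a _ m a0 prim_ba Qam.
have m_le : (m <= e * N)%N.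
  apply: m_min; split; first by rewrite muln_gt0 e_gt0.
  exists s; apply: irreducible_dvdp_root f_irr fx _.
  rewrite rmorphB /= map_polyXn map_polyC rootE !hornerE subr_eq0.
  by rewrite -Da -rmorphXn Ds alg_num_field fmorph_rat.
have eN_d : (e * totient N <= d)%N := leq_trans eN_le deg_a.
have N_d : (totient N <= d)%N by apply: leq_trans eN_d; rewrite leq_pmull.
(* One factor [totient N] is absorbed with [e] into [d]; the other is bounded by [d] separately. *)
apply: leq_trans m_le _; apply: (@leq_trans (e * totient N * (2 * totient N))).
  by rewrite -mulnA leq_mul2l mulnCA mulnn leq_totient_sqr orbT.
by rewrite leq_mul // leq_mul2l N_d.
Qed.
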